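(* Let $n\ge 2$. Then $$(T_1T_2T_1T_2-\lambda_1\lambda_2)(T_2-q)=0$$ in $\operatorname{End}_k(V^{\otimes n})$.
   Context: Setting: $k$ is an algebraically closed field, $q\in k^\times$ with $q^4\neq 1$, $m$ is an integer, $\lambda_1=\frac{q^m}{q-q^{-1}}$, $\lambda_2=\frac{q^{-m}}{q-q^{-1}}$, and it is assumed that $\lambda_1\ne\lambda_2$ and $\lambda_1\neq q^2\lambda_2$. Let $V$ be a $k$-vector space with basis $v_1,v_2$. Define $R\in \operatorname{End}_k(V\otimes V)$ by $R(v_i\otimes v_i)=q\,v_i\otimes v_i$ ($i=1,2$), $R(v_2\otimes v_1)=v_1\otimes v_2$, $R(v_1\otimes v_2)=v_2\otimes v_1+(q-q^{-1})v_1\otimes v_2$. For $1\le i\le n-1$ put $T_{i+1}=\mathrm{Id}^{\otimes (i-1)}\otimes R\otimes \mathrm{Id}^{\otimes (n-i-1)}\in\operatorname{End}_k(V^{\otimes n})$ (so $T_{i+1}$ acts in tensor positions $i,i+1$); these are invertible. For $2\le j\le n$ let $S_j\in\operatorname{End}_k(V^{\otimes n})$ be the linear map which on a basis vector $v=v_{i_1}\otimes\cdots\otimes v_{i_n}$ is $S_j(v)=qv$ if $i_{j-1}=i_j$, and which interchanges the tensor factors in positions $j-1$ and $j$ of $v$ if $i_{j-1}\ne i_j$. Let $\varpi\in\operatorname{End}_k(V^{\otimes n})$ be $\varpi(v_{i_1}\otimes\cdots\otimes v_{i_n})=\lambda_{i_1}\,v_{i_1}\otimes\cdots\otimes v_{i_n}$.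 Let $\theta=S_nS_{n-1}\cdots S_2$ and $$T_1=T_2^{-1}T_3^{-1}\cdots T_n^{-1}\,\theta\,\varpi .$$ *)

(* Defs.v *)
From HB Require Import structures.
From mathcomp Require Import all_boot all_order all_algebra.

Set Implicit Arguments.
Unset Strict Implicit.
Unset Printing Implicit Defensive.

Import GRing.Theory.
Local Open Scope ring_scope.

(* Let V be the k-vector space with basis v_1, v_2.  The tensor power V^{(x)n}*)
(* is realised on its basis v_{i_1} (x) ... (x) v_{i_n}: this basis is indexed*)
(* by the words i_1 ... i_n, and a tensor is its family of coordinates.  The  *)
(* letters 1 and 2 are encoded as 0 and 1 in 'I_2.  Tensor positions are      *)
(* counted from 1 to n; operators indexed by a position j are total in        *)
(* j : nat, and only meaningful for 2 <= j <= n.                              *)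

Notation word n := (n.-tuple 'I_2).
Notation tpow k n := {ffun word n -> (k : fieldType)^o}.

Definition letter1 : 'I_2 := ord0.
Definition letter2 : 'I_2 := ord_max.

Definition letter n (w : word n) (j : nat) : 'I_2 := nth letter1 w j.-1.

(* The word w with the letters in positions j - 1 and j replaced by a and b. *)
Definition put n (w : word n) (j : nat) (a b : 'I_2) : word n :=
  [tuple if i.+2 == j then a else if i.+1 == j then b else tnth w i | i < n].

Section Operators.

Variable k : fieldType.

Definition bvec n (w : word n) : tpow k n := [ffun u => (u == w)%:R].

(* The endomorphism sending each basis vector bvec w to f w. *)
Definition linext n (f : word n -> tpow k n) : 'End(tpow k n) :=
  linfun (fun x : tpow k n => \sum_(w : word n) (x w : k) *: f w).

Variable q : k.

Definition Rmat : 'End(tpow k 2) :=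
  linext (fun w : word 2 =>
    let a := letter w 1 in let b := letter w 2 in
    if a == b then q *: bvec w
    else if a == letter2 then bvec [tuple letter1; letter2]
    else bvec [tuple letter2; letter1]
         + (q - q^-1) *: bvec [tuple letter1; letter2]).

(* Id^{(x)(j-2)} (x) A (x) Id^{(x)(n-j)}: A acts in tensor positions j - 1, j. *)
Definition act_at n (j : nat) (A : 'End(tpow k 2)) : 'End(tpow k n) :=
  linext (fun w : word n =>
    \sum_(u : word 2)
      (A (bvec [tuple letter w j.-1; letter w j]) u : k)
        *: bvec (put w j (letter u 1) (letter u 2))).

Definition opT n (j : nat) : 'End(tpow k n) := act_at n j Rmat.

Definition opS n (j : nat) : 'End(tpow k n) :=
  linext (fun w : word n =>
    if letter w j.-1 == letter w j then q *: bvec w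
    else bvec (put w j (letter w j) (letter w j.-1))).

Variable m : int.

Definition lam (a : 'I_2) : k :=
  if a == letter1 then q ^ m / (q - q^-1) else q ^ (- m) / (q - q^-1).

Definition varpi n : 'End(tpow k n) :=
  linext (fun w : word n => lam (letter w 1) *: bvec w).

(* S_n \o S_(n-1) \o ... \o S_2 *)
Definition theta n : 'End(tpow k n) :=
  \big[@comp_lfun _ _ _ _ / \1%VF]_(j <- rev (index_iota 2 n.+1)) opS n j.

(* T_2^-1 \o T_3^-1 \o ... \o T_n^-1 \o theta \o varpi.  The operator inv_lfun *)
(* is the two-sided inverse on injective endomorphisms such as the T_j.        *)
Definition opT1 n : 'End(tpow k n) :=
  (\big[@comp_lfun _ _ _ _ / \1%VF]_(2 <= j < n.+1) (opT n j)^-1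
    \o (theta n \o varpi n))%VF.

End Operators.

(* Main.v *)
From HB Require Import structures.
Require Import Defs.
From mathcomp Require Import all_boot all_order all_algebra.
From mathcomp Require Import ring.

Set Implicit Arguments.
Unset Strict Implicit.
Unset Printing Implicit Defensive.

Import GRing.Theory.
Local Open Scope ring_scope.

(** Write 1, 2 for the basis of V, and delta = q - q^-1.  Let
    K = T_2^-1 ... T_n^-1 S_n ... S_2, so that T_1 = K varpi ([carry] below).
    Up to a power of q, S_n ... S_2 carries the first letter of a word past all
    the others to the end, and the inverses of the T_j carry it back to the
    front.  Since T_j and S_j with j > 2 do not touch the first position,
    K_(n+1) = T_2^-1 (id (x) K_n) S_2 ([carry_rec]), whence
    by induction ([carry_letter2], [carry_letter1])
      K (2 (x) w) = 2 (x) w,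
      K (1 (x) w) = 1 (x) w - delta 2 (x) E w.
    Here E is the raising operator of quantum sl_2 ([raise]), given by the
    coproduct rule E (1 u) = q 1 (E u), E (2 u) = 1 u + q^-1 2 (E u).

    The image of T_2 - q is spanned by the q-antisymmetric tensors
    a = 1 2 u - q 2 1 u, on which T_2 is - q^-1 by the Hecke relation.
    With the formulas above,
      T_2 T_1 a = lambda_1 (2 1 u - delta 2 2 E u) - q lambda_2 1 2 u,
    and in T_1 T_2 T_1 a the two terms in 2 2 E u cancel, leaving
    - q lambda_1 lambda_2 a ([opT1_opT_opT1_antisym]).  Hence T_1 T_2 T_1 T_2 is
    lambda_1 lambda_2 on the image of T_2 - q. *)

(** * Linear maps and the word basis *)

(** Identities between explicit combinations of tensors hold coordinate by
    coordinate, where they become identities in the field. *)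
Ltac coordwise_field := by apply/ffunP => t; rewrite !ffunE /GRing.scale /=; field.

Section TensorPower.

Variable k : fieldType.

Lemma linfunE (U V : vectType k) (g : U -> V) : linear g -> linfun g =1 g.
Proof.
move=> g_lin x; pose gA := GRing.isLinear.Build _ _ _ _ g g_lin.
pose gL : {linear U -> V} := HB.pack g gA.
by rewrite -[g]/(gL : _ -> _) lfunE.
Qed.

(** Stated for ['Hom(U, V)] only, so that rewriting cannot fire on the other
    linear operations in a goal, such as opposite and scaling. *)
Lemma homD (U V : vectType k) (f : 'Hom(U, V)) x y : f (x + y) = f x + f y.
Proof. exact: linearD. Qed.

Lemma homB (U V : vectType k) (f : 'Hom(U, V)) x y : f (x - y) = f x - f y.
Proof. exact: linearB. Qed.

Lemma homZ (U V : vectType k) (f : 'Hom(U, V)) c x : f (c *: x) = c *: f x.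
Proof. exact: linearZ_LR. Qed.

Lemma sum_bvec n (V : vectType k) (F : word n -> V) w :
  \sum_u (bvec k w u : k) *: F u = F w.
Proof.
rewrite (bigD1 w) //= big1 ?addr0 => [|u neq_uw].
  by rewrite ffunE eqxx scale1r.
by rewrite ffunE (negbTE neq_uw) scale0r.
Qed.

Lemma linextE n (f : word n -> tpow k n) (x : tpow k n) :
  linext f x = \sum_w (x w : k) *: f w.
Proof.
apply: linfunE => a u v; rewrite scaler_sumr -big_split /=.
by apply: eq_bigr => w _; rewrite !ffunE scalerDl scalerA.
Qed.

Lemma bvec_sum n (x : tpow k n) : x = \sum_w (x w : k) *: bvec k w.
Proof.
apply/ffunP => u; rewrite sum_ffunE (bigD1 u) //= big1 ?addr0 => [|w neq_wu].
  by rewrite !ffunE eqxx [RHS]mulr1.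
by rewrite !ffunE eq_sym (negbTE neq_wu) [LHS]mulr0.
Qed.

Lemma eq_on_bvec n (V : vectType k) (f g : 'Hom(tpow k n, V)) :
  (forall w, f (bvec k w) = g (bvec k w)) -> f =1 g.
Proof.
move=> eq_fg x; rewrite (bvec_sum x) !linear_sum /=; apply: eq_bigr => w _.
by rewrite !homZ eq_fg.
Qed.

Lemma linext_bvec n (f : word n -> tpow k n) w : linext f (bvec k w) = f w.
Proof. by rewrite linextE sum_bvec. Qed.

(** * Prepending a letter *)

Lemma letterP (P : 'I_2 -> Prop) : P letter1 -> P letter2 -> forall a, P a.
Proof.
move=> P1 P2 [[|[|//]] lt_a2].
  by rewrite (_ : Ordinal _ = letter1) //; apply: val_inj.
by rewrite (_ : Ordinal _ = letter2) //; apply: val_inj.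
Qed.

Definition consw n (a : 'I_2) (w : word n) : word n.+1 := [tuple of a :: w].

Lemma wordP n (w : word n.+1) : {a & {u | w = consw a u}}.
Proof. by case/tupleP: w => a u; exists a, u. Qed.

Lemma consw_eq n a b (u v : word n) :
  (consw a u == consw b v) = (a == b) && (u == v).
Proof. by rewrite -!val_eqE /= eqseq_cons. Qed.

(** The map x |-> v_a (x) x. *)
Definition consv n (a : 'I_2) : 'Hom(tpow k n, tpow k n.+1) :=
  linfun (fun x : tpow k n =>
    [ffun w => if thead w == a then x [tuple of behead w] else 0]).

(** Components along the first factor, by which operators can be defined by
    recursion on the number of factors. *)
Definition slice n (a : 'I_2) : 'Hom(tpow k n.+1, tpow k n) :=
  linfun (fun x : tpow k n.+1 => [ffun u => x (consw a u)]).

Lemma consvE n a (x : tpow k n) b u :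
  consv n a x (consw b u) = if b == a then x u else 0.
Proof.
rewrite /consv linfunE => [|c y z].
  by rewrite ffunE theadE; case: ifP => // _; congr (x _); apply: val_inj.
by apply/ffunP => w; rewrite !ffunE; case: ifP => //; rewrite scaler0 addr0.
Qed.

Lemma sliceE n a (x : tpow k n.+1) u : slice n a x u = x (consw a u).
Proof.
by rewrite /slice linfunE ?ffunE // => c y z; apply/ffunP => w; rewrite !ffunE.
Qed.

Lemma slice_consv n a b (x : tpow k n) :
  slice n a (consv n b x) = if a == b then x else 0.
Proof. by apply/ffunP => u; rewrite sliceE consvE; case: ifP; rewrite ?ffunE. Qed.

Lemma consv_bvec n a (w : word n) : consv n a (bvec k w) = bvec k (consw a w).
Proof.
apply/ffunP => u; have [b [v ->]] := wordP u.
by rewrite consvE !ffunE consw_eq; case: (b == a).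
Qed.

Lemma eq_on_consv n (V : vectType k) (f g : 'Hom(tpow k n.+1, V)) :
  (forall a x, f (consv n a x) = g (consv n a x)) -> f =1 g.
Proof.
move=> eq_fg; apply: eq_on_bvec => w; have [a [u ->]] := wordP w.
by rewrite -consv_bvec.
Qed.

Lemma eq_on_consv2 n (V : vectType k) (f g : 'Hom(tpow k n.+2, V)) :
  (forall a b x, f (consv n.+1 a (consv n b x)) = g (consv n.+1 a (consv n b x))) ->
  f =1 g.
Proof.
move=> eq_fg; apply: eq_on_consv => a x.
suff /(_ x): (f \o consv _ a)%VF =1 (g \o consv _ a)%VF by rewrite !comp_lfunE.
by apply: eq_on_consv => b y; rewrite !comp_lfunE.
Qed.

Lemma letter_consw n a (w : word n) j : letter (consw a w) j.+2 = letter w j.+1.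
Proof. by []. Qed.

Lemma tnth_consw n a (w : word n) i : tnth (consw a w) (lift ord0 i) = tnth w i.
Proof. by rewrite !(tnth_nth letter1). Qed.

(** The shift of positions is what turns an operator acting at j + 1 into
    id (x) the operator acting at j; it needs j >= 2, since otherwise the first
    letter is itself touched. *)
Lemma put_consw n a (w : word n) j b c :
  put (consw a w) j.+3 b c = consw a (put w j.+2 b c).
Proof.
apply: eq_from_tnth => i; rewrite tnth_mktuple.
case: (unliftP ord0 i) => [i' ->|->] /=; last by [].
by rewrite !tnth_consw tnth_mktuple.
Qed.

Lemma put_consw2 n a b (w : word n) c d :
  put (consw a (consw b w)) 2 c d = consw c (consw d w).
Proof.
apply: eq_from_tnth => i; rewrite tnth_mktuple.
case: (unliftP ord0 i) => [i' ->|->] /=; last by [].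
case: (unliftP ord0 i') => [i'' ->|->] /=; last by [].
by rewrite !tnth_consw.
Qed.

(** * The operators after a prepended letter *)

Lemma big_compE (I : Type) (V : vectType k) (F : I -> 'End(V)) r (x : V) :
  (\big[@comp_lfun _ _ _ _ / \1%VF]_(j <- r) F j) x
    = foldr (fun j y => F j y) x r.
Proof.
elim: r => [|j r IHr] /=; first by rewrite big_nil id_lfunE.
by rewrite big_cons comp_lfunE IHr.
Qed.

Variable q : k.

Local Notation delta := (q - q^-1).

Lemma act_at_bvec n j (A : 'End(tpow k 2)) (w : word n) :
  act_at n j A (bvec k w)
    = \sum_(u : word 2)
        (A (bvec k [tuple letter w j.-1; letter w j]) u : k)
          *: bvec k (put w j (letter u 1) (letter u 2)).
Proof. exact: linext_bvec. Qed.

Lemma act_at_consv n j A a (x : tpow k n) :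
  act_at n.+1 j.+3 A (consv n a x) = consv n a (act_at n j.+2 A x).
Proof.
suff /(_ x): (act_at n.+1 j.+3 A \o consv n a)%VF =1 (consv n a \o act_at n j.+2 A)%VF.
  by rewrite !comp_lfunE.
apply: eq_on_bvec => w; rewrite !comp_lfunE consv_bvec !act_at_bvec.
rewrite linear_sum /=; apply: eq_bigr => u _.
by rewrite homZ put_consw consv_bvec.
Qed.

Lemma opT_consv n j a (x : tpow k n) :
  opT q n.+1 j.+3 (consv n a x) = consv n a (opT q n j.+2 x).
Proof. exact: act_at_consv. Qed.

Lemma opS_consv n j a (x : tpow k n) :
  opS q n.+1 j.+3 (consv n a x) = consv n a (opS q n j.+2 x).
Proof.
suff /(_ x): (opS q n.+1 j.+3 \o consv n a)%VF =1 (consv n a \o opS q n j.+2)%VF.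
  by rewrite !comp_lfunE.
apply: eq_on_bvec => w; rewrite !comp_lfunE consv_bvec !linext_bvec.
rewrite !letter_consw; case: ifP => _; last by rewrite put_consw consv_bvec.
by rewrite homZ consv_bvec.
Qed.

Lemma varpi_consv m n a (x : tpow k n) :
  varpi q m n.+1 (consv n a x) = lam q m a *: consv n a x.
Proof.
suff /(_ x): (varpi q m n.+1 \o consv n a)%VF =1 (lam q m a *: consv n a)%VF.
  by rewrite comp_lfunE scale_lfunE.
by apply: eq_on_bvec => w; rewrite comp_lfunE scale_lfunE consv_bvec linext_bvec.
Qed.

Lemma opT_bvec n a b (w : word n) :
  opT q n.+2 2 (bvec k (consw a (consw b w)))
    = if a == b then q *: bvec k (consw a (consw b w))
      else if a == letter2 then bvec k (consw b (consw a w))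
      else bvec k (consw b (consw a w)) + delta *: bvec k (consw a (consw b w)).
Proof.
rewrite act_at_bvec /Rmat linext_bvec /letter /=.
under eq_bigr do rewrite put_consw2.
pose F (u : word 2) := bvec k (consw (nth letter1 u 0) (consw (nth letter1 u 1) w)).
have sumZ (u : word 2) c :
    \sum_v ((c *: bvec k u) v : k) *: F v = c *: F u.
  rewrite -[in RHS](sum_bvec F u) scaler_sumr; apply: eq_bigr => v _.
  by rewrite ffunE scalerA.
move: a b; do 2![apply: letterP] => /=.
- by rewrite sumZ.
- under eq_bigr do rewrite ffunE scalerDl.
  by rewrite big_split /= sumZ (sum_bvec F).
- by rewrite (sum_bvec F).
- by rewrite sumZ.
Qed.

Lemma opS_head n a b (x : tpow k n) :
  opS q n.+2 2 (consv _ a (consv _ b x))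
    = if a == b then q *: consv _ a (consv _ b x)
      else consv _ b (consv _ a x).
Proof.
pose g := (if a == b then q *: (consv n.+1 a \o consv n b)
           else consv n.+1 b \o consv n a)%VF.
suff /(_ x): (opS q n.+2 2 \o consv _ a \o consv _ b)%VF =1 g.
  by rewrite /g; case: ifP; rewrite ?scale_lfunE !comp_lfunE.
apply: eq_on_bvec => w; rewrite /g !comp_lfunE !consv_bvec linext_bvec /letter /=.
by case: ifP; rewrite ?scale_lfunE comp_lfunE !consv_bvec ?put_consw2.
Qed.

Lemma opT_head n a b (x : tpow k n) :
  opT q n.+2 2 (consv _ a (consv _ b x))
    = if a == b then q *: consv _ a (consv _ b x)
      else if a == letter2 then consv _ b (consv _ a x)
      else consv _ b (consv _ a x) + delta *: consv _ a (consv _ b x).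
Proof.
pose ab := (consv n.+1 a \o consv n b)%VF; pose ba := (consv n.+1 b \o consv n a)%VF.
pose g := if a == b then q *: ab else if a == letter2 then ba else ba + delta *: ab.
suff /(_ x): (opT q n.+2 2 \o consv _ a \o consv _ b)%VF =1 g.
  by rewrite /g; do 2?case: ifP => _; rewrite ?add_lfunE ?scale_lfunE !comp_lfunE.
apply: eq_on_bvec => w; rewrite /g !comp_lfunE !consv_bvec opT_bvec.
by do 2?case: ifP => _; rewrite ?add_lfunE ?scale_lfunE !comp_lfunE !consv_bvec.
Qed.

Hypothesis q_neq0 : q != 0.

(** The Hecke relation (T_j - q) (T_j + q^-1) = 0, which makes T_j - delta an
    inverse of T_j.  It holds for T_2 by inspection and is transported to
    the other positions by [opT_consv]. *)
Lemma opT_quadratic n j (x : tpow k n) : (j.+2 <= n)%N ->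
  opT q n j.+2 (opT q n j.+2 x) = delta *: opT q n j.+2 x + x.
Proof.
elim: n j x => [|[|n] IHn] [|j] x //= le_jn.
  suff /(_ x): (opT q n.+2 2 \o opT q n.+2 2)%VF =1 (delta *: opT q n.+2 2 + \1)%VF.
    by rewrite add_lfunE scale_lfunE comp_lfunE id_lfunE.
  apply: eq_on_consv2 => a b y; rewrite add_lfunE scale_lfunE comp_lfunE id_lfunE.
  move: a b; do 2![apply: letterP]; rewrite !opT_head /= ?homD ?homZ ?opT_head /=;
  coordwise_field.
suff /(_ x): (opT q n.+2 j.+3 \o opT q n.+2 j.+3)%VF =1 (delta *: opT q n.+2 j.+3 + \1)%VF.
  by rewrite add_lfunE scale_lfunE comp_lfunE id_lfunE.
apply: eq_on_consv => a y; rewrite add_lfunE scale_lfunE comp_lfunE id_lfunE.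
by rewrite opT_consv opT_consv (IHn _ _ le_jn) homD homZ.
Qed.

Lemma opT_invE n j (x : tpow k n) : (j.+2 <= n)%N ->
  (opT q n j.+2)^-1%VF x = opT q n j.+2 x - delta *: x.
Proof.
move=> le_jn.
have inj_T : lker (opT q n j.+2) == 0%VS.
  apply/lker0P; apply: (can_inj (g := fun y => opT q n j.+2 y - delta *: y)) => y.
  by rewrite opT_quadratic // addrAC subrr add0r.
apply: (lker0P inj_T); rewrite lker0_lfunVK // homB homZ.
by rewrite opT_quadratic // addrAC subrr add0r.
Qed.

Lemma opT_inv_head n a b (x : tpow k n) :
  (opT q n.+2 2)^-1%VF (consv _ a (consv _ b x))
    = if a == b then q^-1 *: consv _ a (consv _ b x)
      else if a == letter2
           then consv _ b (consv _ a x) - delta *: consv _ a (consv _ b x)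
      else consv _ b (consv _ a x).
Proof.
rewrite opT_invE // opT_head; case: (a == b); first by rewrite -scalerBl subKr.
by case: (a == letter2); rewrite ?addrK.
Qed.

Lemma opT_inv_consv n j a (x : tpow k n) : (j.+2 <= n)%N ->
  (opT q n.+1 j.+3)^-1%VF (consv n a x) = consv n a ((opT q n j.+2)^-1%VF x).
Proof.
move=> le_jn; rewrite (opT_invE _ (j := j.+1) (n := n.+1) le_jn) (opT_invE _ le_jn).
by rewrite opT_consv homB homZ.
Qed.

(** * Carrying the first letter to the end and back *)

(** The factor T_2^-1 ... T_n^-1 S_n ... S_2 of T_1. *)
Definition carry n : 'End(tpow k n) :=
  (\big[@comp_lfun _ _ _ _ / \1%VF]_(2 <= j < n.+1) (opT q n j)^-1 \o theta q n)%VF.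

Lemma opT1E m n (x : tpow k n) : opT1 q m n x = carry n (varpi q m n x).
Proof. by rewrite /opT1 comp_lfunA comp_lfunE. Qed.

Lemma carryE n (x : tpow k n) :
  carry n x = foldr (fun j y => (opT q n j)^-1%VF y)
                (foldr (fun j y => opS q n j y) x (rev (index_iota 2 n.+1)))
                (index_iota 2 n.+1).
Proof. by rewrite comp_lfunE !big_compE. Qed.

(** K_(n+2) = T_2^-1 (id (x) K_(n+1)) S_2: the operators at positions above 2
    leave the first factor alone, and S_2 first moves the letter a behind b. *)
Lemma carry_rec n a b (x : tpow k n) :
  carry n.+2 (consv _ a (consv _ b x))
    = (if a == b then q else 1)
        *: (opT q n.+2 2)^-1%VF (consv _ b (carry n.+1 (consv _ a x))).
Proof.
rewrite !carryE; set r := index_iota 2 n.+2.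
have -> : index_iota 2 n.+3 = 2 :: map succn r.
  by rewrite /r /index_iota !subSS !subn0 /= -(iotaDl 1).
have r_bounds j : j \in r -> exists2 i, j = i.+2 & (i.+2 <= n.+1)%N.
  by rewrite mem_index_iota; case: j => [|[|i]] //= le_in; exists i.
rewrite rev_cons -map_rev foldr_rcons opS_head.
have -> : (if a == b then q *: consv _ a (consv _ b x) else consv _ b (consv _ a x))
    = (if a == b then q else 1) *: consv _ b (consv _ a x).
  by case: eqP => [->|]; rewrite ?scale1r.
set c := if _ then _ else _; set y := consv _ a x.
have S_shift s : {subset s <= r} ->
    foldr (fun j z => opS q n.+2 j z) (c *: consv _ b y) (map succn s)
    = c *: consv _ b (foldr (fun j z => opS q n.+1 j z) y s).
  elim: s => //= j s IHs sub_r.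
  have [i -> _] := r_bounds j (sub_r _ (mem_head _ _)).
  rewrite IHs => [|i' s_i']; last by rewrite sub_r // inE s_i' orbT.
  by rewrite homZ opS_consv.
have T_shift s z : {subset s <= r} ->
    foldr (fun j z => (opT q n.+2 j)^-1%VF z) (c *: consv _ b z) (map succn s)
    = c *: consv _ b (foldr (fun j z => (opT q n.+1 j)^-1%VF z) z s).
  elim: s => //= j s IHs sub_r.
  have [i -> le_in] := r_bounds j (sub_r _ (mem_head _ _)).
  rewrite IHs => [|i' s_i']; last by rewrite sub_r // inE s_i' orbT.
  by rewrite homZ opT_inv_consv.
rewrite S_shift => [|j]; last by rewrite mem_rev.
by rewrite /= T_shift // linearZ.
Qed.

(** The raising operator of quantum sl_2, by its coproduct E (x) 1 + K (x) E
    with K = diag(q, q^-1). *)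
Fixpoint raise n : 'End(tpow k n) :=
  match n with
  | 0 => 0
  | p.+1 => (consv p letter1 \o slice p letter2
     + q *: (consv p letter1 \o (raise p \o slice p letter1))
     + q^-1 *: (consv p letter2 \o (raise p \o slice p letter2)))%VF
  end.

Lemma raise_consv1 n (x : tpow k n) :
  raise n.+1 (consv _ letter1 x) = q *: consv _ letter1 (raise n x).
Proof.
rewrite /= !add_lfunE !scale_lfunE !comp_lfunE !slice_consv /=.
by rewrite !linear0 add0r addr0.
Qed.

Lemma raise_consv2 n (x : tpow k n) :
  raise n.+1 (consv _ letter2 x)
    = consv _ letter1 x + q^-1 *: consv _ letter2 (raise n x).
Proof.
rewrite /= !add_lfunE !scale_lfunE !comp_lfunE !slice_consv /=.
by rewrite !linear0 addr0.
Qed.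

Lemma carry_id1 (x : tpow k 1) : carry 1 x = x.
Proof. by rewrite carryE. Qed.

(** A letter 2 always moves as a plain swap or a power of q under the inverses
    of the T_j, so the way back undoes the way to the end. *)
Lemma carry_letter2 n (x : tpow k n) :
  carry n.+1 (consv _ letter2 x) = consv _ letter2 x.
Proof.
elim: n x => [|n IHn] x; first exact: carry_id1.
pose f := (carry n.+2 \o consv _ letter2)%VF.
suff /(_ x): f =1 consv _ letter2 by rewrite comp_lfunE.
apply: eq_on_consv => a y; rewrite comp_lfunE carry_rec IHn opT_inv_head.
by move: a; apply: letterP; rewrite /= ?scale1r // scalerA divff // scale1r.
Qed.

(** On the way back the carried letter 1 may be exchanged with a letter 2 that
    it meets, at the cost of - delta; the sum over the places where this happens
    is E. *)
Lemma carry_letter1 n (x : tpow k n) :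
  carry n.+1 (consv _ letter1 x)
    = consv _ letter1 x - delta *: consv _ letter2 (raise n x).
Proof.
elim: n x => [|n IHn] x.
  by rewrite carry_id1 lfunE /= linear0 scaler0 subr0.
pose f := (carry n.+2 \o consv _ letter1)%VF.
suff /(_ x): f =1 (consv _ letter1 - delta *: (consv _ letter2 \o raise n.+1))%VF.
  rewrite add_lfunE opp_lfunE scale_lfunE.
  by rewrite (comp_lfunE (carry _)) (comp_lfunE _ (raise _)).
apply: eq_on_consv => a y; rewrite add_lfunE opp_lfunE scale_lfunE.
rewrite (comp_lfunE (carry _)) (comp_lfunE _ (raise _)).
rewrite carry_rec IHn !(homB, homZ) !opT_inv_head.
move: a; apply: letterP => /=.
  by rewrite raise_consv1 homZ; coordwise_field.
rewrite raise_consv2 homD homZ.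
coordwise_field.
Qed.

(** * The q-antisymmetric tensors *)

Variable m : int.
Local Notation lam1 := (lam q m letter1).
Local Notation lam2 := (lam q m letter2).

Lemma opT1_letter1 n (x : tpow k n) :
  opT1 q m n.+1 (consv _ letter1 x)
    = lam1 *: (consv _ letter1 x - delta *: consv _ letter2 (raise n x)).
Proof. by rewrite opT1E varpi_consv homZ carry_letter1. Qed.

Lemma opT1_letter2 n (x : tpow k n) :
  opT1 q m n.+1 (consv _ letter2 x) = lam2 *: consv _ letter2 x.
Proof. by rewrite opT1E varpi_consv homZ carry_letter2. Qed.

(** The tensors that make up the image of T_2 - q; T_2 is - q^-1 on them, by the
    Hecke relation. *)
Definition antisym n (u : tpow k n) : tpow k n.+2 :=
  consv _ letter1 (consv _ letter2 u) - q *: consv _ letter2 (consv _ letter1 u).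

Lemma opT_antisym n (u : tpow k n) :
  opT q n.+2 2 (antisym u) = - q^-1 *: antisym u.
Proof. rewrite homB homZ !opT_head /antisym /=; coordwise_field. Qed.

Lemma opT_subq_head n a b (u : tpow k n) :
  exists c, opT q n.+2 2 (consv _ a (consv _ b u)) - q *: consv _ a (consv _ b u)
    = c *: antisym u.
Proof.
rewrite opT_head /antisym; move: a b; do 2![apply: letterP] => /=.
- by exists 0; coordwise_field.
- by exists (- q^-1); coordwise_field.
- by exists 1; coordwise_field.
- by exists 0; coordwise_field.
Qed.

(** Applying T_2 removes the term 1 2 u coming from lambda_1, so each remaining
    term of T_2 T_1 a meets the other scalar at the second T_1: this is why the
    product lambda_1 lambda_2 factors out. *)
Lemma opT1_opT_opT1_antisym n (u : tpow k n) :
  opT1 q m n.+2 (opT q n.+2 2 (opT1 q m n.+2 (antisym u)))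
    = - (q * lam1 * lam2) *: antisym u.
Proof.
have T1a : opT1 q m n.+2 (antisym u) =
    lam1 *: (consv _ letter1 (consv _ letter2 u)
             - delta *: consv _ letter2 (consv _ letter1 u)
             - (delta / q) *: consv _ letter2 (consv _ letter2 (raise n u)))
    - (q * lam2) *: consv _ letter2 (consv _ letter1 u).
  rewrite homB homZ opT1_letter1 opT1_letter2 raise_consv2 homD homZ.
  coordwise_field.
have T2T1a : opT q n.+2 2 (opT1 q m n.+2 (antisym u)) =
    lam1 *: (consv _ letter2 (consv _ letter1 u)
             - delta *: consv _ letter2 (consv _ letter2 (raise n u)))
    - (q * lam2) *: consv _ letter1 (consv _ letter2 u).
  rewrite T1a !(homB, homZ) !opT_head /=; coordwise_field.
rewrite T2T1a !(homB, homZ) opT1_letter1 !opT1_letter2 raise_consv2 homD homZ.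
rewrite /antisym; coordwise_field.
Qed.

Lemma opT1_opT_relation n :
  ((opT1 q m n.+2 \o opT q n.+2 2 \o opT1 q m n.+2 \o opT q n.+2 2
      - (lam1 * lam2) *: \1)
     \o (opT q n.+2 2 - q *: \1))%VF = 0.
Proof.
apply/lfunP; apply: eq_on_consv2 => a b u; have [c Tc] := opT_subq_head a b u.
rewrite zero_lfunE comp_lfunE [X in fun_of_lfun _ X](_ : _ = c *: antisym u); last first.
  by rewrite add_lfunE opp_lfunE scale_lfunE id_lfunE.
rewrite add_lfunE opp_lfunE scale_lfunE id_lfunE 3!comp_lfunE.
rewrite !homZ opT_antisym !homZ opT1_opT_opT1_antisym !scalerA -scalerBl.
by rewrite [X in X *: _](_ : _ = 0) ?scale0r //; field.
Qed.

End TensorPower.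

Theorem theorem1 (k : closedFieldType) (q : k) (m : int) (n : nat)
    (hq0 : q != 0) (hq4 : q ^+ 4 != 1)
    (hlam12 : lam q m letter1 != lam q m letter2)
    (hlam12q : lam q m letter1 != q ^+ 2 * lam q m letter2)
    (hn : (2 <= n)%N) :
  ((opT1 q m n \o opT q n 2 \o opT1 q m n \o opT q n 2
      - (lam q m letter1 * lam q m letter2) *: \1)
     \o (opT q n 2 - q *: \1))%VF = 0 :> 'End(tpow k n).
Proof.
by case: n hn => [|[|n]] // _; exact: opT1_opT_relation.
Qed.
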